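(* Let $\Gamma=(\gamma_1,\dots,\gamma_r)$ be a tuple of symmetric free polynomials in $x=(x_1,\dots,x_g)$ with $g\le r$ and $\gamma_j=x_j$ for $1\le j\le g$. Suppose $\mathcal K\subseteq\mathbb S(\mathbb C)^g$ is $\Gamma$-convex, contains $0$, and $\Gamma(0)=0$. The real span of $\{\gamma_j:1\le j\le r\}$ contains a polynomial $q\in\mathbb C\langle x\rangle$ such that $q(X)\succeq 0$ for $X\in\mathcal K$ if and only if $0$ is not in the interior of $\mathrm{matco}(\Gamma(\mathcal K))(1)\subseteq\mathbb R^r$.
   Context: Free polynomials are elements of the free algebra $\mathbb C\langle x\rangle$ in noncommuting variables $x_1,\dots,x_g$, with the conjugate-linear involution fixing each $x_j$ and reversing words; $p$ is symmetric if $p^*=p$. $\mathbb S_n(\mathbb C)$ is the set of self-adjoint $n\times n$ complex matrices and $\mathbb S(\mathbb C)^g=(\mathbb S_n(\mathbb C)^g)_{n\ge1}$; $\mathbb S_1(\mathbb C)^r=\mathbb R^r$. Polynomials are evaluated at $X\in\mathbb S_n(\mathbb C)^g$ by substituting $X_j$ for $x_j$, and $\Gamma(X)=(\gamma_1(X),\dots,\gamma_r(X))\in\mathbb S_n(\mathbb C)^r$. $T\succeq 0$ means $T$ is positive semidefinite. A subset $\mathcal K\subseteq\mathbb S(\mathbb C)^g$ is a sequence $(\mathcal K(n))_n$ with $\mathcal K(n)\subseteq\mathbb S_n(\mathbb C)^g$; $\Gamma(\mathcal K)$ is the levelwise image. $\mathcal K$ is a free set if it is closed under direct sums, simultaneous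 unitary similarity, and restriction to reducing subspaces. A $\Gamma$-pair is $(X,V)$ with $X\in\mathbb S_n(\mathbb C)^g$ and $V:\mathbb C^m\to\mathbb C^n$ an isometry such that $V^*\Gamma(X)V=\Gamma(V^*XV)$ (coordinatewise). $\mathcal K$ is $\Gamma$-convex if it is free and $V^*XV\in\mathcal K$ whenever $X\in\mathcal K$ and $(X,V)$ is a $\Gamma$-pair. Matrix convex means free and closed under compressions $X\mapsto V^*XV$ by all isometries $V$. $\mathrm{matco}(\mathcal S)$ is the intersection of all matrix convex sets containing $\mathcal S$; $\mathrm{matco}(\mathcal S)(1)$ is its first level.
   Formalization: The polynomial q must be a real combination of the γ_j with coefficients not all zero (so q ≠ 0 when the γ_j are linearly independent); as literally stated q = 0 always qualifies and the equivalence fails, e.g. for Γ = x and K all self-adjoint matrices. *)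

(* Defs.v *)
From HB Require Import structures.
From mathcomp Require Export all_boot all_order all_algebra.
From mathcomp Require Export sesquilinear spectral.
From mathcomp Require Export classical_sets reals topology normedtype.
From mathcomp Require Export finmap complex.
(* The notations of monalg clash with those of mathcomp-analysis. *)
From mathcomp Require Export -(notations) monalg.

Set Implicit Arguments.
Unset Strict Implicit.
Unset Printing Implicit Defensive.

Import Order.TTheory GRing.Theory Num.Theory.
Import numFieldNormedType.Exports.

Local Open Scope classical_set_scope.
Local Open Scope ring_scope.
Local Open Scope complex_scope.
Local Open Scope sesquilinear_scope.

(* The free algebra C<x_1, ..., x_g>: the monoid algebra over C = R[i] of the
   free monoid on 'I_g. *)
Notation free_poly R g := (malg (fmonom 'I_g) R[i]).

Definition free_var (R : realType) (g : nat) (i : 'I_g) : free_poly R g :=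
  mkmalgU (fmu i) 1.

Definition free_star (R : realType) (g : nat) (p : free_poly R g) :
    free_poly R g :=
  \sum_(w <- msupp p) mkmalgU (FMonom (rev w)) (conjc (mcoeff w p)).

Definition free_symmetric (R : realType) (g : nat) (p : free_poly R g) : Prop :=
  free_star p = p.

(* Matrices have positive size, so sizes are indexed by their predecessor:
   mxtuple R g n consists of g-tuples of (n+1) x (n+1) matrices, and index 0
   is the first level. *)
Definition mxtuple (R : realType) (g n : nat) := 'I_g -> 'M[R[i]]_n.+1.

Definition free_eval (R : realType) (g n : nat) (X : mxtuple R g n)
    (p : free_poly R g) : 'M[R[i]]_n.+1 :=
  mmap (fun c : R[i] => c%:M)
       (fun w : fmonom 'I_g => \prod_(i <- fmonom_val w) X i) p.

Definition free_evals (R : realType) (g r : nat) (Gam : 'I_r -> free_poly R g)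
    (n : nat) (X : mxtuple R g n) : mxtuple R r n :=
  fun j => free_eval X (Gam j).

Definition sa_tuple (R : realType) (g n : nat) (X : mxtuple R g n) : Prop :=
  forall j, X j \is hermsymmx.

Definition psd (R : realType) (n : nat) (A : 'M[R[i]]_n) : Prop :=
  A \is hermsymmx /\ forall v : 'cV[R[i]]_n, 0 <= (v^t* *m A *m v) 0 0.

Definition isometry_mx (R : realType) (n m : nat) (V : 'M[R[i]]_(n, m)) : Prop :=
  V^t* *m V = 1%:M.

Definition compress (R : realType) (g n m : nat) (V : 'M[R[i]]_(n.+1, m.+1))
    (X : mxtuple R g n) : mxtuple R g m :=
  fun j => V^t* *m X j *m V.

(* (n + m.+1).+1 is convertible to n.+1 + m.+1. *)
Definition dsum (R : realType) (g n m : nat) (X : mxtuple R g n)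
    (Y : mxtuple R g m) : mxtuple R g (n + m.+1) :=
  fun j => block_mx (X j) 0 0 (Y j).

Definition orthocomp (R : realType) (n : nat) (W : set 'cV[R[i]]_n) :
    set 'cV[R[i]]_n :=
  [set v | forall w, W w -> w^t* *m v = 0].

Definition reducing (R : realType) (g n : nat) (X : mxtuple R g n)
    (W : set 'cV[R[i]]_n.+1) : Prop :=
  forall j, (forall v, W v -> W (X j *m v)) /\
            (forall v, orthocomp W v -> orthocomp W (X j *m v)).

Definition mxset (R : realType) (g : nat) := forall n, set (mxtuple R g n).

Definition mxsubset (R : realType) (g : nat) (S T : mxset R g) : Prop :=
  forall n, S n `<=` T n.

(* The restriction of X to a reducing subspace W of dimension m+1 is written in
   an orthonormal basis of W: an isometry V with range W. *)
Definition free_set (R : realType) (g : nat) (K : mxset R g) : Prop :=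
  [/\ forall n, K n `<=` @sa_tuple R g n,
      forall n m (X : mxtuple R g n) (Y : mxtuple R g m),
        K n X -> K m Y -> K (n + m.+1)%N (dsum X Y),
      forall n (X : mxtuple R g n) (U : 'M[R[i]]_n.+1),
        U \is unitarymx -> K n X -> K n (compress U X)
    & forall n m (X : mxtuple R g n) (V : 'M[R[i]]_(n.+1, m.+1)),
        isometry_mx V -> reducing X (range (fun u : 'cV_m.+1 => V *m u)) ->
        K n X -> K m (compress V X)].

Definition Gamma_pair (R : realType) (g r : nat) (Gam : 'I_r -> free_poly R g)
    (n m : nat) (X : mxtuple R g n) (V : 'M[R[i]]_(n.+1, m.+1)) : Prop :=
  [/\ sa_tuple X, isometry_mx V
    & forall j, compress V (free_evals Gam X) j
              = free_evals Gam (compress V X) j].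

Definition Gamma_convex (R : realType) (g r : nat)
    (Gam : 'I_r -> free_poly R g) (K : mxset R g) : Prop :=
  free_set K /\
  forall n m (X : mxtuple R g n) (V : 'M[R[i]]_(n.+1, m.+1)),
    K n X -> Gamma_pair Gam X V -> K m (compress V X).

Definition matrix_convex (R : realType) (g : nat) (K : mxset R g) : Prop :=
  free_set K /\
  forall n m (X : mxtuple R g n) (V : 'M[R[i]]_(n.+1, m.+1)),
    K n X -> isometry_mx V -> K m (compress V X).

Definition matco (R : realType) (g : nat) (S : mxset R g) : mxset R g :=
  fun n => [set X | forall T : mxset R g,
                      matrix_convex T -> mxsubset S T -> T n X].
Arguments matco {R g} S n.

Definition Gamma_image (R : realType) (g r : nat) (Gam : 'I_r -> free_poly R g)
    (K : mxset R g) : mxset R r :=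
  fun n => [set free_evals Gam X | X in K n].
Arguments Gamma_image {R g r} Gam K n.

(* The first level as a subset of R^r, a real number being identified with the
   corresponding 1 x 1 matrix. *)
Definition real_level1 (R : realType) (r : nat) (S : mxset R r) : set 'rV[R]_r :=
  [set y | S 0%N (fun j => ((y 0 j)%:C)%:M)].

Definition zero_tuple (R : realType) (g n : nat) : mxtuple R g n := fun=> 0.
Arguments zero_tuple R g n : clear implicits.

(* Main.v *)
(** Both directions are duality in R^r. If the combination q of the gamma_j
    with coefficients c is positive on K, then the tuples Y with
    c_1 Y_1 + ... + c_r Y_r positive semidefinite form a matrix convex set
    containing Gamma(K), so matco(Gamma(K))(1) lies in the half-space
    { c . y >= 0 }. Conversely, matco(Gamma(K))(1) is convex, so if 0 is not
    interior then some c <> 0 satisfies c . y >= 0 on it; applying this to the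
    compressions v^* Gamma(X) v, which lie in matco(Gamma(K))(1) for unit v,
    gives v^* q(X) v >= 0. *)

Require Import Defs.
From HB Require Import structures.
From mathcomp Require Import boolp lra.
Set Implicit Arguments.
Unset Strict Implicit.
Unset Printing Implicit Defensive.
Import Order.TTheory GRing.Theory Num.Theory.
Import numFieldNormedType.Exports.
Local Open Scope classical_set_scope.
Local Open Scope ring_scope.
Local Open Scope complex_scope.
Local Open Scope sesquilinear_scope.

(** * Supporting functionals of convex cones and convex sets in R^n *)

Definition convex_cone (R : realType) (n : nat) (P : set 'rV[R]_n) : Prop :=
  [/\ P 0, forall x y, P x -> P y -> P (x + y)
    & forall t x, 0 <= t -> P x -> P (t *: x)].

(* The line spanned by u can be added to P without filling the space, which is
   what lets the dimension drop by one. When P meets both w + R z and - w + R z,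
   u = w + s z with s = sup { a | w + a z in P }, and then z is missed. *)
Lemma convex_cone_line (R : realType) (n : nat) (P : set 'rV[R]_n)
    (z w : 'rV[R]_n) :
  convex_cone P -> ~ P z -> (forall a, w != a *: z) ->
  exists2 u, u != 0 & exists v, forall t, ~ P (v + t *: u).
Proof.
move=> [P0 PD PZ] Pz wz.
have z0 : z != 0 by apply/eqP => z0; rewrite z0 in Pz.
have [[a0 Pa0]|A0] := pselect (exists a, P (w + a *: z)); last first.
  by exists z => //; exists w => t Pt; apply: A0; exists t.
have [[b0 Pb0]|B0] := pselect (exists b, P (- w + b *: z)); last first.
  by exists z => //; exists (- w) => t Pt; apply: B0; exists t.
(* The sum of the two points is [(a + b) *: z], so a + b > 0 would put z in the cone. *)
have AB a b : P (w + a *: z) -> P (- w + b *: z) -> a <= - b.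
  move=> Pa Pb; rewrite leNgt; apply/negP => ab; apply: Pz.
  have ab0 : 0 < a + b by lra.
  rewrite -[z]scale1r -(mulVf (lt0r_neq0 ab0)) -scalerA.
  apply: PZ; first by rewrite invr_ge0 ltW.
  have -> : (a + b) *: z = (w + a *: z) + (- w + b *: z).
    by rewrite addrACA subrr add0r scalerDl.
  exact: PD.
pose A := [set a | P (w + a *: z)].
have Asup : has_sup A by split; [exists a0|exists (- b0) => a /AB; apply].
pose s := sup A.
have As a : A a -> a <= s by move=> Aa; apply: sup_upper_bound.
have sB b : P (- w + b *: z) -> s <= - b.
  by move=> Pb; apply: ge_sup; [exists a0|move=> a /AB; apply].
exists (w + s *: z).
  by apply: contra_neq (wz (- s)) => /eqP; rewrite addr_eq0 scaleNr => /eqP.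
exists z => t Pt.
(* Dividing by |t| gives a point of P on - w + R z (t < 0) or on w + R z (t > 0), each beyond the
   bound set by s; t = 0 would give z in P. *)
have [t0|t0|t0] := ltgtP t 0.
- have it0 : t^-1 < 0 by rewrite invr_lt0.
  have : P (- w + (- t^-1 - s) *: z).
    have -> : - w + (- t^-1 - s) *: z = - t^-1 *: (z + t *: (w + s *: z)).
      rewrite scalerDr scalerA mulNr mulVf ?lt_eqF// scaleN1r opprD scalerBl.
      by rewrite addrCA addrA.
    by apply: PZ => //; lra.
  move=> /sB; lra.
- have it0 : 0 < t^-1 by rewrite invr_gt0.
  have : A (t^-1 + s).
    rewrite /A/=.
    have -> : w + (t^-1 + s) *: z = t^-1 *: (z + t *: (w + s *: z)).
      rewrite scalerDr scalerA mulVf ?gt_eqF// scale1r scalerDl.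
      by rewrite addrCA.
    by apply: PZ => //; lra.
  move=> /As; lra.
- by move: Pt; rewrite t0 scale0r addr0.
Qed.

(** The columns of M are a basis of the functionals vanishing at u, so [y *m M] is the class of y
    modulo the line of u. Injectivity on columns makes a nonzero functional c on the quotient pull
    back to a nonzero [M *m c]. *)
Lemma quotient_line (F : fieldType) (n : nat) (u : 'rV[F]_n.+1) :
  u != 0 -> exists M : 'M[F]_(n.+1, n),
    (forall y, y *m M = 0 -> exists t, y = t *: u) /\
    (forall c : 'cV[F]_n, M *m c = 0 -> c = 0).
Proof.
move=> u0; have rku : \rank (kermx u^T) = n.
  by rewrite mxrank_ker mxrank_tr rank_rV u0 subn1.
(* The width is kept as a rank so that [row_base] fits by its type. *)
suff : exists M : 'M[F]_(n.+1, \rank (kermx u^T)),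
    (forall y, y *m M = 0 -> exists t, y = t *: u) /\
    (forall c : 'cV[F]_(\rank (kermx u^T)), M *m c = 0 -> c = 0).
  by rewrite rku.
pose B := row_base (kermx u^T).
have uB : u *m B^T = 0.
  apply: trmx_inj; rewrite trmx_mul trmxK trmx0.
  by apply/sub_kermxP; rewrite eq_row_base.
exists B^T; split=> [y yB|c].
  suff /sub_rVP[t ->] : (y <= u)%MS by exists t.
  have ker_u : (kermx B^T == u)%MS.
    rewrite andbC -(geq_leqif (mxrank_leqif_eq _)); last exact/sub_kermxP.
    by rewrite mxrank_ker mxrank_tr eq_row_base rku rank_rV u0 subSnn.
  by rewrite -(eqmxP ker_u); apply/sub_kermxP.
move=> Bc; apply: trmx_inj; rewrite trmx0.
have fB : row_free B by rewrite /row_free eq_row_base.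
by apply: (row_free_inj fB); rewrite mul0mx -[B]trmxK -trmx_mul Bc trmx0.
Qed.

(** Induction on the dimension: modulo the line u of [convex_cone_line] the image of P is still a
    proper cone, since it misses the class of v, and its functional pulls back. *)
Lemma convex_cone_support (R : realType) (n : nat) (P : set 'rV[R]_n) :
  convex_cone P -> (exists z, ~ P z) ->
  exists2 c : 'cV[R]_n, c != 0 & forall p, P p -> 0 <= (p *m c) 0 0.
Proof.
elim: n P => [|n IHn] P coneP [z Pz].
  by case: coneP => P0 _ _; case: Pz; rewrite [z]thinmx0.
have [[w wz]|] := pselect (exists w : 'rV[R]_n.+1, forall a, w != a *: z).
  have [u u0 [v Pvu]] := convex_cone_line coneP Pz wz.
  have [M [Mker Minj]] := quotient_line u0.
  case: coneP => P0 PD PZ.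
  case: (IHn [set p *m M | p in P]) => [||c c0 Pc].
  - split; first by exists 0; rewrite ?mul0mx.
      move=> _ _ [x Px <-] [y Py <-]; exists (x + y); last by rewrite mulmxDl.
      exact: PD.
    move=> t _ t0 [x Px <-]; exists (t *: x); rewrite -?scalemxAl//.
    exact: PZ.
  - exists (v *m M) => -[p Pp pv].
    have [|t pvt] := Mker (p - v); first by rewrite mulmxBl pv subrr.
    by apply: (Pvu t); rewrite -pvt addrC subrK.
  exists (M *m c); first by apply: contra_neq c0; apply: Minj.
  by move=> p Pp; rewrite mulmxA; apply: Pc; exists p.
move=> /forallNP wz; have {}wz w : exists a, w = a *: z.
  by have /existsNP[a /negP/negPn/eqP ->] := wz w; exists a.
(* Here the space is R z, and P contains no positive multiple of z. *)
exists (- z^T).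
  rewrite oppr_eq0 trmx_eq0; apply/eqP => z0; apply: Pz; rewrite z0.
  by case: coneP.
move=> p Pp; have [a pa] := wz p.
have a0 : a <= 0.
  rewrite leNgt; apply/negP => a0; apply: Pz.
  case: coneP => _ _ PZ.
  rewrite -[z]scale1r -(mulVf (lt0r_neq0 a0)) -scalerA -pa.
  by apply: PZ => //; rewrite invr_ge0 ltW.
rewrite pa mulmxN -scalemxAl 2!mxE -mulNr mulr_ge0 ?oppr_ge0// !mxE.
by apply: sumr_ge0 => i _; rewrite mxE -expr2 sqr_ge0.
Qed.

(** The cone P generated by C has a supporting functional unless it is the whole space. In that case
    C contains small multiples of all vectors ['e_j] and [- 'e_j], hence by convexity a ball about
    0. *)
Lemma convex_set_support (R : realType) (n : nat) (C : set 'rV[R]_n) :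
  C 0 ->
  (forall t s x y, 0 <= t -> 0 <= s -> t + s = 1 -> C x -> C y ->
    C (t *: x + s *: y)) ->
  ~ interior C 0 ->
  exists2 c : 'cV[R]_n, c != 0 & forall y, C y -> 0 <= (y *m c) 0 0.
Proof.
move=> C0 Cconv intC.
pose P := [set p | exists t y, [/\ 0 <= t, C y & p = t *: y]].
have Cshrink t y : 0 <= t <= 1 -> C y -> C (t *: y).
  move=> /andP[t0 t1] Cy; rewrite -[t *: y]addr0 -(scaler0 _ (1 - t)).
  by apply: Cconv => //; [rewrite subr_ge0|rewrite addrC subrK].
have coneP : convex_cone P.
  split; first by exists 0, 0; rewrite scaler0.
  - move=> _ _ [t [x [t0 Cx ->]]] [s [y [s0 Cy ->]]].
    have [ts0|ts0] := eqVneq (t + s) 0.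
      have -> : t = 0 by lra.
      have -> : s = 0 by lra.
      by exists 0, 0; rewrite !scale0r addr0.
    exists (t + s), ((t / (t + s)) *: x + (s / (t + s)) *: y); split.
    + exact: addr_ge0.
    + apply: Cconv => //; rewrite ?divr_ge0 ?addr_ge0//.
      by rewrite -mulrDl divff.
    + by rewrite scalerDr !scalerA ![(t + s) * _]mulrC !divfK.
  - move=> t _ t0 [s [y [s0 Cy ->]]]; exists (t * s), y.
    by rewrite mulr_ge0// scalerA.
have [PT|/existsNP nP] := pselect (forall z, P z); last first.
  have [c c0 Pc] := convex_cone_support coneP nP.
  by exists c => // y Cy; apply: Pc; exists 1, y; rewrite scale1r.
case: intC.
have small (z : 'rV[R]_n) : \forall e \near (0 : R)^'+, C (e *: z).
  have [t [y [t0 Cy ->]]] := PT z.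
  near=> e; rewrite scalerA; apply: Cshrink => //.
  (* The bound e <= 1 / (t + 1) ensures e t <= 1 and makes sense for t = 0. *)
  rewrite mulr_ge0//=; apply: (@le_trans _ _ ((t + 1)^-1 * t)).
    rewrite ler_wpM2r//; near: e; apply: nbhs_right_le.
    by rewrite invr_gt0; lra.
  by rewrite mulrC ler_pdivrMr; lra.
(* The point x is the average of the [y j], or 0 when s is empty. *)
have Csum (y : 'I_n -> 'rV[R]_n) s : (forall j, C (y j)) ->
    exists2 x, C x & \sum_(j <- s) y j = (size s)%:R *: x.
  move=> Cy; elim: s => [|j s [x Cx sx]].
    by exists 0 => //; rewrite big_nil scaler0.
  have m0 : ((size s).+1%:R : R) != 0 by rewrite pnatr_eq0.
  exists ((size s).+1%:R^-1 *: y j + ((size s)%:R / (size s).+1%:R) *: x).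
    apply: Cconv => //; rewrite ?divr_ge0 ?invr_ge0//.
    by rewrite -[X in X + _]mul1r -mulrDl -[1 + _]mulrS divff.
  by rewrite big_cons sx scalerDr !scalerA mulrCA divff// mulr1 scale1r.
have [e [e0 Ce]] : exists e : R, 0 < e /\
    forall j : 'I_n, C (e *: 'e_j) /\ C (e *: - 'e_j).
  near (0 : R)^'+ => e; exists e; split => //.
  near: e; apply: filter_forall => j; near=> e; split; near: e; exact: small.
have Caxis (x : 'rV[R]_n) j : `|x 0 j| <= e -> C (x 0 j *: 'e_j).
  move=> xe; have [Cp Cn] := Ce j.
  have xe01 : 0 <= `|x 0 j| / e <= 1.
    by rewrite divr_ge0 ?(ltW e0)//= ler_pdivrMr// mul1r.
  have [x0|x0] := leP 0 (x 0 j).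
    move: (Cshrink _ _ xe01 Cp).
    by rewrite scalerA divfK ?gt_eqF// ger0_norm.
  move: (Cshrink _ _ xe01 Cn).
  by rewrite scalerA divfK ?gt_eqF// ltr0_norm// scalerN scaleNr opprK.
(* For x in this ball each coordinate of (n + 1) x is at most e in absolute value, so (n + 1) x is a
   sum of n points of C and x is n / (n + 1) times their average. Using n + 1 also covers n = 0. *)
apply/nbhs_ballP; exists (e / n.+1%:R); first by rewrite /= divr_gt0.
move=> x [_ xe].
have n0 : (n.+1%:R : R) != 0 by rewrite pnatr_eq0.
have [j|y Cy] := Csum (fun j => (n.+1%:R *: x) 0 j *: 'e_j) (enum 'I_n).
  apply: Caxis; rewrite mxE normrM normr_nat mulrC -ler_pdivlMr//.
  by have := xe 0 j; rewrite mxE /ball/= sub0r normrN => /ltW.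
rewrite big_enum -(row_sum_delta (n.+1%:R *: x)) size_enum_ord => nx.
have -> : x = (n%:R / n.+1%:R) *: y.
  by rewrite mulrC -scalerA -nx scalerA mulVf// scale1r.
apply: Cshrink => //; rewrite divr_ge0//= ler_pdivrMr// mul1r.
by rewrite ler_nat.
Unshelve. all: by end_near.
Qed.

(** * Adjoints, self-adjoint and positive semidefinite matrices *)

Lemma hermsymmxP (C : numClosedFieldType) (n : nat) (A : 'M[C]_n) :
  reflect (A^t* = A) (A \is hermsymmx).
Proof.
apply: (iffP (is_hermitianmxP _ _ _)); rewrite expr0 scale1r.
  by move=> {2}->.
by move=> ->.
Qed.

Lemma adjmxM (C : numClosedFieldType) (m n p : nat) (A : 'M[C]_(m, n))
    (B : 'M[C]_(n, p)) : (A *m B)^t* = B^t* *m A^t*.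
Proof. by rewrite trmx_mul map_mxM. Qed.

Lemma adjmxK (C : numClosedFieldType) (m n : nat) (A : 'M[C]_(m, n)) :
  A^t*^t* = A.
Proof. by apply/matrixP => i j; rewrite !mxE conjCK. Qed.

Lemma adjmxZ (C : numClosedFieldType) (m n : nat) (a : C) (A : 'M[C]_(m, n)) :
  (a *: A)^t* = a^*%R *: A^t*.
Proof. by apply/matrixP => i j; rewrite !mxE rmorphM. Qed.

Lemma hermsymmx_compress (C : numClosedFieldType) (m n : nat) (A : 'M[C]_n)
    (V : 'M[C]_(n, m)) : A \is hermsymmx -> V^t* *m A *m V \is hermsymmx.
Proof.
by move=> /hermsymmxP hA; apply/hermsymmxP; rewrite !adjmxM adjmxK hA mulmxA.
Qed.

Lemma psd_compress (R : realType) (m n : nat) (A : 'M[R[i]]_n)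
    (V : 'M[R[i]]_(n, m)) : psd A -> psd (V^t* *m A *m V).
Proof.
move=> [hA A0]; split; first exact: hermsymmx_compress.
by move=> v; have := A0 (V *m v); rewrite adjmxM !mulmxA.
Qed.

Lemma hermsymmx_block (C : numClosedFieldType) (m n : nat) (A : 'M[C]_m)
    (B : 'M[C]_n) :
  A \is hermsymmx -> B \is hermsymmx -> block_mx A 0 0 B \is hermsymmx.
Proof.
move=> /hermsymmxP hA /hermsymmxP hB; apply/hermsymmxP.
by rewrite tr_block_mx map_block_mx hA hB !trmx0 !map_mx0.
Qed.

Lemma psd_block (R : realType) (m n : nat) (A : 'M[R[i]]_m) (B : 'M[R[i]]_n) :
  psd A -> psd B -> psd (block_mx A 0 0 B).
Proof.
move=> [hA A0] [hB B0]; split; first exact: hermsymmx_block.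
move=> v; rewrite -[v]vsubmxK tr_col_mx map_row_mx mul_row_block mul_row_col.
by rewrite !mulmx0 addr0 add0r mxE addr_ge0.
Qed.

(** * Evaluation of free polynomials at matrix tuples *)

Lemma free_eval_is_zmod_morphism (R : realType) (g n : nat)
    (X : mxtuple R g n) :
  zmod_morphism (free_eval X).
Proof. exact: mmap_is_additive. Qed.

HB.instance Definition _ (R : realType) (g n : nat) (X : mxtuple R g n) :=
  Algebra.isZmodMorphism.Build (free_poly R g) 'M[R[i]]_n.+1 (free_eval X)
    (free_eval_is_zmod_morphism X).

Lemma free_evalU (R : realType) (g n : nat) (X : mxtuple R g n) c w :
  free_eval X (mkmalgU w c) = c *: \prod_(i <- fmonom_val w) X i.
Proof. by rewrite -mul_scalar_mx; apply: mmapU. Qed.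

Lemma free_evalE (R : realType) (g n : nat) (X : mxtuple R g n)
    (p : free_poly R g) :
  free_eval X p =
  \sum_(w <- msupp p) mcoeff w p *: \prod_(i <- fmonom_val w) X i.
Proof. by apply: eq_bigr => w _; rewrite -mul_scalar_mx. Qed.

Lemma free_evalZ (R : realType) (g n : nat) (X : mxtuple R g n) c
    (p : free_poly R g) :
  free_eval X (c *: p) = c *: free_eval X p.
Proof.
(* The support shrinks when c = 0, so both sums are taken over that of p. *)
rewrite [in RHS]free_evalE scaler_sumr /free_eval (mmapEw (msuppZ_le _ _)).
by apply: eq_bigr => w _; rewrite linearZ /= scalerA -mul_scalar_mx.
Qed.

(** The adjoint of a product of self-adjoint [X i] is the product over the reversed word, so
    evaluation turns [free_star] into the adjoint. *)
Lemma free_eval_hermsymmx (R : realType) (g n : nat) (X : mxtuple R g n)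
    (p : free_poly R g) :
  sa_tuple X -> free_symmetric p -> free_eval X p \is hermsymmx.
Proof.
move=> saX symp; apply/hermsymmxP; rewrite -[in RHS]symp.
have prod_rev (s : seq 'I_g) : (\prod_(i <- s) X i)^t* = \prod_(i <- rev s) X i.
  elim: s => [|i s IHs]; first by rewrite !big_nil trmx1 map_mx1.
  rewrite big_cons rev_cons -cats1 big_cat /= big_seq1 -IHs.
  by rewrite [LHS]adjmxM (hermsymmxP _ (saX i)).
rewrite free_evalE /free_star raddf_sum /= raddf_sum /= raddf_sum /=.
apply: eq_bigr => w _; rewrite free_evalU /= linearZ /= -prod_rev.
by apply/matrixP => i j; rewrite !mxE rmorphM.
Qed.

Lemma free_eval_lin (R : realType) (g r n : nat) (X : mxtuple R g n)
    (Gam : 'I_r -> free_poly R g) (c : 'I_r -> R[i]) :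
  free_eval X (\sum_(j < r) c j *: Gam j) =
  \sum_(j < r) c j *: free_eval X (Gam j).
Proof. by rewrite raddf_sum; apply: eq_bigr => j _; rewrite /= free_evalZ. Qed.

(** * Matrix convex sets and their first level *)

(** A convex combination is the compression of the direct sum of x and y by the isometry with column
    (sqrt t, sqrt s). *)
Lemma real_level1_convex (R : realType) (r : nat) (T : mxset R r) :
  matrix_convex T -> forall t s x y, 0 <= t -> 0 <= s -> t + s = 1 ->
  real_level1 T x -> real_level1 T y -> real_level1 T (t *: x + s *: y).
Proof.
move=> [[_ Tsum _ _] Tcomp] t s x y t0 s0 ts1 Tx Ty.
pose V : 'M[R[i]]_(0.+1 + 0.+1, 1) :=
  col_mx ((Num.sqrt t)%:C)%:M ((Num.sqrt s)%:C)%:M.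
have adjV : V^t* = row_mx ((Num.sqrt t)%:C)%:M ((Num.sqrt s)%:C)%:M.
  rewrite tr_col_mx map_row_mx !tr_scalar_mx !map_scalar_mx /=.
  by congr row_mx; congr (_%:M); apply/eqP; rewrite eq_complex /= oppr0 !eqxx.
have isoV : isometry_mx V.
  rewrite /isometry_mx adjV mul_row_col -!scalar_mxM -!rmorphM/=.
  by rewrite -!expr2 !sqr_sqrtr// -raddfD/= -rmorphD/= ts1.
have compV (A B : 'M[R[i]]_1) :
    V^t* *m block_mx A 0 0 B *m V = t%:C *: A + s%:C *: B.
  rewrite adjV mul_row_block mul_row_col !mulmx0 addr0 add0r !mul_scalar_mx.
  by rewrite !mul_mx_scalar !scalerA -!rmorphM /= -!expr2 !sqr_sqrtr.
have := Tcomp _ _ _ _ (Tsum _ _ _ _ Tx Ty) isoV.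
rewrite /real_level1 /=; congr (T 0%N _); apply/funext => j.
by rewrite [LHS]compV !scale_scalar_mx -raddfD /= !mxE -!rmorphM -rmorphD.
Qed.

Lemma hermsymmx_form_real (R : realType) (n : nat) (A : 'M[R[i]]_n)
    (v : 'cV[R[i]]_n) :
  A \is hermsymmx ->
  (v^t* *m A *m v) 0 0 = (complex.Re ((v^t* *m A *m v) 0 0))%:C.
Proof.
move=> /(hermsymmx_compress v)/hermsymmxP/matrixP/(_ 0 0).
rewrite 2![in LHS]mxE; case: (_ 0 0) => a b /eqP.
rewrite eq_complex /= eqxx /= => /eqP ?.
by apply/eqP; rewrite eq_complex /= eqxx /=; apply/eqP; lra.
Qed.

(** A unit vector is an isometry from C, so it compresses Y to the first level; the entries are real
    because Y is self-adjoint, and [Re] loses nothing. *)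
Lemma real_level1_vector_state (R : realType) (r n : nat) (T : mxset R r)
    (Y : mxtuple R r n) (v : 'cV[R[i]]_n.+1) :
  matrix_convex T -> T n Y -> isometry_mx v ->
  real_level1 T (\row_j complex.Re ((v^t* *m Y j *m v) 0 0)).
Proof.
move=> [[Tsa _ _ _] Tcomp] TY isov; have Tv := Tcomp _ _ _ _ TY isov.
rewrite /real_level1 /=; move: (Tv); congr (T 0%N _); apply/funext => j.
by rewrite mxE -(hermsymmx_form_real _ (Tsa _ _ TY j)) [LHS]mx11_scalar.
Qed.

Lemma block_diag_comb (C : pzRingType) (m n r : nat) (c : 'I_r -> C)
    (A : 'I_r -> 'M[C]_m) (B : 'I_r -> 'M[C]_n) :
  \sum_j c j *: block_mx (A j) 0 0 (B j) =
  block_mx (\sum_j c j *: A j) 0 0 (\sum_j c j *: B j).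
Proof.
elim/big_rec3: _ => [|j x y z _ ->]; first by rewrite block_mx0.
by rewrite scale_block_mx add_block_mx !scaler0 !addr0.
Qed.

(** The sum is linear in Y, so it commutes with compressions and direct sums, and both preserve
    positivity. *)
Lemma matrix_convex_psd (R : realType) (r : nat) (c : 'I_r -> R[i]) :
  matrix_convex (fun n => [set Y : mxtuple R r n |
    sa_tuple Y /\ psd (\sum_j c j *: Y j)]).
Proof.
have comp n m (X : mxtuple R r n) (V : 'M[R[i]]_(n.+1, m.+1)) :
    sa_tuple X /\ psd (\sum_j c j *: X j) ->
    sa_tuple (compress V X) /\ psd (\sum_j c j *: compress V X j).
  move=> [saX pX]; split; first by move=> j; apply: hermsymmx_compress.
  rewrite (_ : \sum_j _ = V^t* *m (\sum_j c j *: X j) *m V).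
    exact: psd_compress.
  rewrite mulmx_sumr mulmx_suml; apply: eq_bigr => j _.
  by rewrite -scalemxAr -scalemxAl.
split; last by move=> n m X V HX _; apply: comp.
split.
- by move=> n X [].
- move=> n m X Y [saX pX] [saY pY]; split.
    by move=> j; exact: (hermsymmx_block (saX j) (saY j)).
  rewrite [X in psd X](block_diag_comb c X Y).
  exact: (psd_block pX pY).
- by move=> n X U _; apply: comp.
- by move=> n m X V _ _; apply: comp.
Qed.

(** For c nonzero this supplies a point of C where the functional c is negative. *)
Lemma real_level1_scale_interior (R : realType) (r : nat) (C : set 'rV[R]_r)
    (c : 'rV[R]_r) :
  interior C 0 -> exists2 t, 0 < t & C (- (t *: c)).
Proof.
move=> /nbhs_ballP[e /= e0 eC]; have c0 := normr_ge0 c.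
have d0 : 0 < 1 + `|c| by lra.
exists (e / (1 + `|c|)); first exact: divr_gt0.
apply: eC; rewrite mx_norm_ball /ball_ /= sub0r opprK normrZ.
rewrite gtr0_norm ?divr_gt0//.
by rewrite mulrAC ltr_pdivrMr// mulrDr mulr1; lra.
Qed.

(** A nonzero v is a times a unit vector, with a its norm, and the form scales by a^2. *)
Lemma psd_of_unit_vectors (R : realType) (n : nat) (A : 'M[R[i]]_n) :
  A \is hermsymmx ->
  (forall v : 'cV[R[i]]_n, isometry_mx v -> 0 <= (v^t* *m A *m v) 0 0) ->
  psd A.
Proof.
move=> hA A0; split=> // v; have [->|v0] := eqVneq v 0.
  by rewrite mulmx0 mxE.
have vv : 0 < (v^t* *m v) 0 0.
  have sqv i : 0 <= v^t* 0 i * v i 0 by rewrite !mxE mulrC mul_conjC_ge0.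
  rewrite mxE lt_def sumr_ge0 ?andbT//; apply: contra_neq v0 => /eqP.
  rewrite psumr_eq0// => /allP v0; apply/colP => i; rewrite mxE; apply/eqP.
  have := v0 i (mem_index_enum _); rewrite !mxE.
  by rewrite mulrC mul_conjC_eq0.
pose a := sqrtC ((v^t* *m v) 0 0).
have a0 : 0 < a by rewrite sqrtC_gt0.
have aC : (a^-1)^*%R = a^-1 by apply/CrealP; rewrite ger0_real// invr_ge0 ltW.
pose u := a^-1 *: v.
have adju : u^t* = a^-1 *: v^t* by rewrite adjmxZ aC.
have ui : isometry_mx u.
  rewrite /isometry_mx adju -scalemxAl -scalemxAr scalerA [_ *m _]mx11_scalar.
  rewrite scale_scalar_mx -expr2 exprVn sqrtCK mulVf//.
  exact: lt0r_neq0.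
have -> : v = a *: u by rewrite scalerA divff ?scale1r// gt_eqF.
rewrite adjmxZ.
have -> : a^*%R = a by apply/CrealP; rewrite ger0_real// ltW.
rewrite -scalemxAr -!scalemxAl scalerA mxE mulr_ge0 ?A0//.
by rewrite mulr_ge0// ltW.
Qed.

Theorem theorem2p6 (R : realType) (g r : nat) (le_gr : (g <= r)%N)
    (Gam : 'I_r -> free_poly R g)
    (Gam_sym : forall j, free_symmetric (Gam j))
    (Gam_var : forall i : 'I_g, Gam (widen_ord le_gr i) = free_var R i)
    (K : mxset R g)
    (K_convex : Gamma_convex Gam K)
    (K_zero : K 0%N (zero_tuple R g 0))
    (Gam_zero : forall j, free_evals Gam (zero_tuple R g 0) j = 0) :
  (exists c : 'rV[R]_r, c != 0 /\
     exists q : free_poly R g, q = \sum_(j < r) (c 0 j)%:C *: Gam j /\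
       forall n (X : mxtuple R g n), K n X -> psd (free_eval X q))
  <-> ~ interior (real_level1 (matco (Gamma_image Gam K))) 0.
Proof.
have [[Ksa _ _ _] _] := K_convex.
have saGam n (X : mxtuple R g n) : K n X -> sa_tuple (free_evals Gam X).
  by move=> KX j; apply: free_eval_hermsymmx => //; apply: Ksa.
split=> [[c [c0 [q [-> q0]]]] intC|intC].
  have [t t0] := real_level1_scale_interior c intC.
  (* The point - t c of the hull lies in this particular matrix convex set, which contains the image
     of K because q is positive on K. *)
  move=> /(_ _ (matrix_convex_psd (fun j => (c 0 j)%:C)))[].
    move=> n _ [X KX <-]; split; first exact: saGam.
    by have := q0 _ _ KX; rewrite free_eval_lin.
  move=> _ [_ /(_ 1%:M)].
  rewrite trmx1 map_mx1 mul1mx mulmx1.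
  (* At - t c the combination is the scalar - t |c|^2; its positivity forces c = 0. *)
  rewrite (_ : \sum_j _ = (- (t * \sum_j c 0 j ^+ 2))%:C%:M); last first.
    rewrite mulr_sumr -sumrN !raddf_sum; apply: eq_bigr => j _ /=.
    rewrite !mxE scale_scalar_mx -rmorphM; congr (_%:C%:M).
    by rewrite mulrN expr2 mulrCA.
  rewrite mxE eqxx mulr1n lecR oppr_ge0 pmulr_rle0// => c_le0.
  move/eqP: c0; apply; apply/rowP => j; rewrite mxE; apply/eqP.
  have : \sum_j c 0 j ^+ 2 == 0.
    by rewrite eq_le c_le0 sumr_ge0// => i _; rewrite sqr_ge0.
  rewrite psumr_eq0 => [/allP/(_ j (mem_index_enum _))|i _].
    by rewrite /= sqrf_eq0.
  exact: sqr_ge0.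
have [| |c c0 Cc] := convex_set_support _ _ intC.
(* The origin is the image of the zero tuple, as Gamma(0) = 0. *)
- move=> T mT; apply; exists (zero_tuple R g 0) => //.
  by apply/funext => j; rewrite Gam_zero mxE raddf0.
- move=> t s x y t0 s0 ts Cx Cy T mT ST.
  by apply: (real_level1_convex mT) => //; [apply: Cx|apply: Cy].
exists c^T; split; first by rewrite trmx_eq0.
exists (\sum_(j < r) (c^T 0 j)%:C *: Gam j); split=> // n X KX.
rewrite free_eval_lin; apply: psd_of_unit_vectors.
  (* q(X) is self-adjoint because the coefficients are real. *)
  apply/hermsymmxP; rewrite raddf_sum /= raddf_sum; apply: eq_bigr => j _.
  rewrite [LHS]adjmxZ (hermsymmxP _ (saGam _ _ KX j)).
  by congr (_ *: _); apply/eqP; rewrite eq_complex /= oppr0 !eqxx.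
move=> v isov.
have {}/Cc : real_level1 (matco (Gamma_image Gam K))
    (\row_j complex.Re ((v^t* *m free_evals Gam X j *m v) 0 0)).
  move=> T mT ST; apply: (real_level1_vector_state mT) => //.
  by apply: ST; exists X.
(* The value of the functional c at this point, viewed in C, is v^* q(X) v. *)
rewrite -lecR; congr (_ <= _).
rewrite mulmx_sumr mulmx_suml summxE mxE rmorph_sum; apply: eq_bigr => j _.
rewrite -scalemxAr -scalemxAl [RHS]mxE (hermsymmx_form_real _ (saGam _ _ KX j)).
by rewrite [LHS]rmorphM mulrC; congr (_%:C * _%:C); rewrite mxE.
Qed.
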